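(* Let $F=F(S)$ be the free group over a set $S$ with $|S|\geq 2$, and let $\sigma\in\ell^\infty$. Then the Gromov norm of the class $[\partial g_\sigma]_{\mathrm{b}}\in\mathrm{H}^2_{\mathrm{b}}(F,\mathbb{R})$ satisfies $$\|[\partial g_\sigma]_{\mathrm{b}}\|=\mathrm{def}\,\sigma .$$
   Context: Bounded cohomology: for a group $\Gamma$, let $C^n(\Gamma)$ be the space of maps $\Gamma^n\to\mathbb{R}$ and $C^n_{\mathrm{b}}(\Gamma)$ the subspace of bounded maps. The coboundary maps (trivial real coefficients) are, in the relevant degrees, $\partial f(x,y)=f(y)-f(xy)+f(x)$ for $f\in C^1(\Gamma)$ and $\partial f(x,y,z)=f(y,z)-f(xy,z)+f(x,yz)-f(x,y)$ for $f\in C^2(\Gamma)$. Then $\mathrm{H}^2_{\mathrm{b}}(\Gamma,\mathbb{R})=\ker(\partial:C^2_{\mathrm{b}}(\Gamma)\to C^3_{\mathrm{b}}(\Gamma))/\mathrm{im}(\partial:C^1_{\mathrm{b}}(\Gamma)\to C^2_{\mathrm{b}}(\Gamma))$, and $[\,\cdot\,]_{\mathrm{b}}$ denotes the class of a bounded 2-cocycle. The Gromov norm of $\alpha\in\mathrm{H}^2_{\mathrm{b}}(\Gamma,\mathbb{R})$ is $\|\alpha\|=\inf_{f\in\alpha}\|f\|_\infty$, the infimum over all bounded 2-cocycles $f$ representing $\alpha$, where $\|\cdot\|_\infty$ is the supremum norm. A map $f:\Gamma\to\mathbb{R}$ is a quasi-morphism if its defect $\mathrm{def}\,f:=\sup_{x,y\in\Gamma}|f(x)+f(y)-f(xy)|$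 is finite; then $\partial f$ is a bounded 2-cocycle. An element $x\in F(S)$ is called a power if $x=s^k$ for some $s\in S$ and $k\in\mathbb{Z}$. Each non-trivial $x\in F$ has a unique shortest factorization into powers, called the factorization of $x$: $x=x_0\cdots x_n$ with $x_i=s_i^{k_i}$, $s_i\in S$, $k_i\in\mathbb{Z}\setminus\{0\}$, and $s_i\neq s_{i+1}$ for $0\le i<n$. $\ell^\infty$ is the space of bounded real sequences $\sigma=(\sigma(k))_{k\geq1}$. Each $\sigma\in\ell^\infty$ is extended to an odd function $\sigma:\mathbb{Z}\to\mathbb{R}$, i.e. $\sigma(-k)=-\sigma(k)$ and $\sigma(0)=0$, and $\mathrm{def}\,\sigma=\sup_{k,l\in\mathbb{Z}}|\sigma(k)+\sigma(l)-\sigma(k+l)|$. The map $g_\sigma:F\to\mathbb{R}$ is defined on powers by $g_\sigma(s^k)=\sigma(k)$, and for $x$ with factorization $x=x_0\cdots x_n$ by $g_\sigma(x)=\sum_{i=0}^n g_\sigma(x_i)$. Each $g_\sigma$ is a quasi-morphism. *)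

(* Defs.v *)
From HB Require Import structures.
From mathcomp Require Import all_boot all_order all_algebra.
From mathcomp Require Import all_classical all_reals.
From mathcomp Require Import topology normedtype.
From mathcomp Require Import zify ring lra.

Set Implicit Arguments.
Unset Strict Implicit.
Unset Printing Implicit Defensive.

Import Order.TTheory GRing.Theory Num.Theory.
Import numFieldNormedType.Exports.

Local Open Scope classical_set_scope.
Local Open Scope ring_scope.

(* Bounded cohomology with trivial real coefficients. Cochains are uncurried  *)
(* functions: C^1 = G -> R, C^2 = G * G -> R, C^3 = G * G * G -> R.           *)

Definition sup_norm (R : realType) (T : Type) (f : T -> R) : R :=
  sup (range (fun t => `|f t|)).

Section BoundedCohomology.
Context {R : realType} {G : groupType}.

Definition coboundary1 (f : G -> R) : G * G -> R :=
  fun '(x, y) => f y - f (x * y)%g + f x.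

Definition coboundary2 (f : G * G -> R) : G * G * G -> R :=
  fun '(x, y, z) => f (y, z) - f (x * y, z)%g + f (x, y * z)%g - f (x, y).

Definition Z2b : pred (G * G -> R) :=
  fun f => `[< bounded_fun f /\ coboundary2 f = 0 >].

Lemma bounded_funP (T : Type) (f : T -> R) :
  bounded_fun f <-> exists M : R, forall x, `|f x| <= M.
Proof.
split=> [[M [_ hM]]|[M hM]].
  by exists (M + 1) => x; apply: (hM (M + 1)); rewrite ?ltrDl.
exists M; split; first exact: num_real.
by move=> N MN x _; exact: le_trans (hM x) (ltW MN).
Qed.

Lemma bounded_funB (T : Type) (f g : T -> R) :
  bounded_fun f -> bounded_fun g -> bounded_fun (f - g).
Proof.
move=> /bounded_funP[M hM] /bounded_funP[N hN]; apply/bounded_funP.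
by exists (M + N) => x; exact: le_trans (ler_normB _ _) (lerD _ _).
Qed.

Lemma bounded_fun0 (T : Type) : bounded_fun (0 : T -> R).
Proof. by apply/bounded_funP; exists 0 => x; rewrite normr0. Qed.

Lemma coboundary1_0 : coboundary1 0 = 0.
Proof. by apply/funext => -[x y] /=; rewrite subr0 addr0. Qed.

Lemma coboundary1B f g : coboundary1 (f - g) = coboundary1 f - coboundary1 g.
Proof.
apply/funext => -[x y].
rewrite /coboundary1 !fctE; ring.
Qed.

Lemma coboundary2_0 : coboundary2 0 = 0.
Proof. by apply/funext => -[[x y] z] /=; rewrite !subr0 addr0. Qed.

Lemma coboundary2B f g : coboundary2 (f - g) = coboundary2 f - coboundary2 g.
Proof.
apply/funext => -[[x y] z].
rewrite /coboundary2 !fctE; ring.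
Qed.

Lemma coboundary2_coboundary1 f : coboundary2 (coboundary1 f) = 0.
Proof.
apply/funext => -[[x y] z].
rewrite /coboundary2 /coboundary1 mulgA; cbn; ring.
Qed.

Lemma Z2b_zmod_closed : zmod_closed Z2b.
Proof.
split=> [|f g /asboolP[bf cf] /asboolP[bg cg]]; apply/asboolP.
  by split; [exact: bounded_fun0 | exact: coboundary2_0].
by split; [exact: bounded_funB | rewrite coboundary2B cf cg subrr].
Qed.

HB.instance Definition _ :=
  GRing.isZmodClosed.Build (G * G -> R) Z2b Z2b_zmod_closed.

Record cocycle2b := Cocycle2b {
  cochain :> G * G -> R;
  _ : Z2b cochain
}.

HB.instance Definition _ := [isSub for cochain].
HB.instance Definition _ := [Choice of cocycle2b by <:].
HB.instance Definition _ := [SubChoice_isSubZmodule of cocycle2b by <:].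

Definition B2b : pred cocycle2b :=
  fun c => `[< exists2 b : G -> R, bounded_fun b & cochain c = coboundary1 b >].

Lemma B2b_zmod_closed : zmod_closed B2b.
Proof.
split=> [|c d /asboolP[b hb cb] /asboolP[e he de]]; apply/asboolP.
  by exists 0; [exact: bounded_fun0 | rewrite coboundary1_0].
exists (b - e); first exact: bounded_funB.
by rewrite coboundary1B -cb -de.
Qed.

HB.instance Definition _ :=
  GRing.isZmodClosed.Build cocycle2b B2b B2b_zmod_closed.

Definition H2b := Quotient.quot (GRing.ZmodClosed.clone cocycle2b B2b _).

HB.instance Definition _ := GRing.Zmodule.on H2b.

Definition bclass (c : cocycle2b) : H2b := (\pi c)%qT.

Lemma bclass_eqP (c d : cocycle2b) : bclass c = bclass d <->
  exists2 b : G -> R, bounded_fun b & cochain c - cochain d = coboundary1 b.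
Proof.
rewrite /bclass; split=> [/eqP|h]; last apply/eqP.
  by rewrite -Quotient.idealrBE => /asboolP.
by rewrite -Quotient.idealrBE; apply/asboolP.
Qed.

Definition gromov_norm (a : H2b) : R :=
  inf [set sup_norm (cochain c) | c in [set c | bclass c = a]].

Definition quasimorphism (f : G -> R) : Prop :=
  bounded_fun (fun '(x, y) => f x + f y - f (x * y)%g).

Lemma coboundary1_Z2b f : quasimorphism f -> Z2b (coboundary1 f).
Proof.
move=> /bounded_funP[M hM]; apply/asboolP; split; last first.
  exact: coboundary2_coboundary1.
apply/bounded_funP; exists M => -[x y] /=.
by have := hM (x, y); rewrite (addrC (f x)) addrAC.
Qed.

Definition coboundary_cocycle f (qf : quasimorphism f) : cocycle2b :=
  Cocycle2b (coboundary1_Z2b qf).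

End BoundedCohomology.
Arguments Z2b : clear implicits.
Arguments cocycle2b : clear implicits.
Arguments B2b : clear implicits.
Arguments H2b : clear implicits.

Definition expgz (G : groupType) (x : G) (k : int) : G :=
  match k with Posz n => x ^+ n | Negz n => x ^- n.+1 end%g.

Section FreeGroup.
Context {S : choiceType}.
Implicit Types (s : S) (k l : int) (p q : S * int) (u v w : seq (S * int)).

(* The word [:: (s_0, k_0); ...; (s_n, k_n)] stands for s_0^k_0 ... s_n^k_n;  *)
(* an element of F(S) is represented by its factorization into powers, the    *)
(* neutral element by the empty word. That this is the free group over S, and *)
(* that these words are the unique shortest factorizations into powers, is    *)
(* proved in free_group_universal and factorization_shortest below.           *)
Definition reduced w :=
  all (fun p => p.2 != 0) w && sorted (fun p q => p.1 != q.1) w.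

(* left multiplication of a reduced word by a power *)
Definition push p w :=
  if p.2 == 0 then w else
  if w is q :: w' then
    if p.1 == q.1 then
      if p.2 + q.2 == 0 then w' else (p.1, p.2 + q.2) :: w'
    else p :: w
  else [:: p].

Definition wmul u v := foldr push v u.

Definition winv u := rev [seq (p.1, - p.2) | p <- u].

Lemma reduced_cons p w : reduced (p :: w) =
  [&& p.2 != 0, (if w is q :: _ then p.1 != q.1 else true) & reduced w].
Proof.
rewrite /reduced; case: w => [|q w] //=; first by rewrite !andbT.
by case: (p.2 != 0); case: (q.2 != 0); case: (p.1 != q.1); case: all.
Qed.

Lemma push_reduced p w : reduced w -> reduced (push p w).
Proof.
rewrite /push; case: (altP (p.2 =P 0)) => // p0.
case: w => [|q w]; first by rewrite reduced_cons p0.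
case: (altP (p.1 =P q.1)) => [pq|pq]; last first.
  by move=> rw; rewrite reduced_cons p0 pq.
rewrite reduced_cons => /and3P[q0 qw rw].
by case: (altP (p.2 + q.2 =P 0)) => // pq0; rewrite reduced_cons pq0 pq qw.
Qed.

Lemma push_cons p w : reduced (p :: w) -> push p w = p :: w.
Proof.
rewrite reduced_cons /push => /and3P[/negPf-> + _].
by case: w => [|q w] // /negPf->.
Qed.

Lemma push_push s k l w : reduced w ->
  push (s, k) (push (s, l) w) = push (s, k + l) w.
Proof.
rewrite {2 3}/push /=; case: (altP (l =P 0)) => [->|l0]; first by rewrite addr0.
case: w => [|[t m] w] /=.
  rewrite /push /= eqxx.
  by case: (altP (k =P 0)) => [->|//]; rewrite add0r (negPf l0).
rewrite reduced_cons /= => /and3P[m0 tw rw].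
case: (altP (s =P t)) => [->{s}|st]; last first.
  rewrite /push /= eqxx.
  by case: (altP (k =P 0)) => [->|k0]; rewrite ?add0r ?(negPf l0).
case: (altP (l + m =P 0)) => [lm|lm].
  have -> : k + l + m = k by rewrite -addrA lm addr0.
  have -> : (k + l == 0) = (k == m).
    by move: lm => /eqP; rewrite addrC addr_eq0 => /eqP->; rewrite addr_eq0.
  rewrite /push /=; case: (altP (k =P 0)) => [->|k0].
    by rewrite eq_sym (negPf m0).
  by case: (altP (k =P m)) => [->|km]; case: w tw {rw} => [|[t' n] w'] //= /negPf->.
rewrite /push /= eqxx; case: (altP (k =P 0)) => [->|k0].
  by rewrite !add0r (negPf l0) (negPf lm).
rewrite !addrA; case: (altP (k + l =P 0)) => // ->.
by rewrite add0r (negPf m0).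
Qed.

Lemma wmul_reduced u v : reduced v -> reduced (wmul u v).
Proof. by move=> rv; elim: u => //= p u; exact: push_reduced. Qed.

Lemma wmul_push p u v : reduced v -> wmul (push p u) v = push p (wmul u v).
Proof.
case: p => s k rv; rewrite [in LHS]/push /=.
case: (altP (k =P 0)) => [->|k0] //.
case: u => [|[t m] u] //=.
case: (altP (s =P t)) => [->|//].
rewrite push_push ?wmul_reduced //.
by case: (altP (k + m =P 0)) => [->|//]; rewrite /push eqxx.
Qed.

Lemma wmulA u v w : reduced w -> wmul u (wmul v w) = wmul (wmul u v) w.
Proof. by move=> rw; elim: u => //= p u ->; rewrite wmul_push. Qed.

Lemma wmulw1 u : reduced u -> wmul u [::] = u.
Proof.
elim: u => //= p u IH ru; rewrite IH ?push_cons //.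
by move: ru; rewrite reduced_cons => /and3P[].
Qed.

Lemma winv_reduced u : reduced u -> reduced (winv u).
Proof.
rewrite /reduced /winv all_rev all_map rev_sorted sorted_map => /andP[h1 h2].
apply/andP; split; first by apply: sub_all h1 => p /=; rewrite oppr_eq0.
by apply: sub_sorted h2 => p q /=; rewrite eq_sym.
Qed.

Lemma wmulVw u : reduced u -> wmul (winv u) u = [::].
Proof.
elim: u => //= -[s k] u IH ru; rewrite /winv map_cons rev_cons /= /wmul.
have := ru; rewrite reduced_cons => /and3P[/= k0 _ /IH {}IH].
by rewrite foldr_rcons /push /= oppr_eq0 (negPf k0) eqxx addNr eqxx.
Qed.

Lemma winvK u : winv (winv u) = u.
Proof.
rewrite /winv map_rev revK -map_comp map_id_in // => -[s k] _ /=.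
by rewrite opprK.
Qed.

Lemma wmulwV u : reduced u -> wmul u (winv u) = [::].
Proof. by move=> /winv_reduced/wmulVw; rewrite winvK. Qed.

Record free_group := FreeGroup {
  factorization :> seq (S * int);
  _ : reduced factorization
}.

HB.instance Definition _ := [isSub for factorization].
HB.instance Definition _ := [Choice of free_group by <:].

Implicit Types x y z : free_group.

Lemma factorization_reduced x : reduced x.
Proof. by case: x. Qed.

Definition fg_one := @FreeGroup [::] isT.
Definition fg_mul x y := FreeGroup (wmul_reduced x (factorization_reduced y)).
Definition fg_inv x := FreeGroup (winv_reduced (factorization_reduced x)).

Lemma fg_mulA : associative fg_mul.
Proof.
by move=> x y z; apply: val_inj; rewrite /= wmulA ?factorization_reduced.
Qed.

Lemma fg_mul1 : left_id fg_one fg_mul.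
Proof. by move=> x; exact: val_inj. Qed.

Lemma fg_mulr1 : right_id fg_one fg_mul.
Proof.
by move=> x; apply: val_inj; rewrite /= wmulw1 ?factorization_reduced.
Qed.

Lemma fg_mulV : left_inverse fg_one fg_inv fg_mul.
Proof.
by move=> x; apply: val_inj; rewrite /= wmulVw ?factorization_reduced.
Qed.

Lemma fg_mulrV : right_inverse fg_one fg_inv fg_mul.
Proof.
by move=> x; apply: val_inj; rewrite /= wmulwV ?factorization_reduced.
Qed.

HB.instance Definition _ :=
  isGroup.Build free_group fg_mulA fg_mul1 fg_mulr1 fg_mulV fg_mulrV.

Definition gen s : free_group := @FreeGroup [:: (s, 1)] isT.

Lemma factorizationM x y : factorization (x * y)%g = wmul x y.
Proof. by []. Qed.

Lemma factorization_expgz s k :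
  factorization (expgz (gen s) k) = push (s, k) [::].
Proof.
have e n : factorization (gen s ^+ n)%g = push (s, n%:Z) [::].
  elim: n => [|n IH] //; rewrite expgS factorizationM IH.
  by rewrite [wmul _ _]/= push_push.
case: k => n; first exact: e.
rewrite /expgz [LHS](_ : _ = winv (gen s ^+ n.+1)%g) // e.
by rewrite /push /= NegzE.
Qed.

Definition eval_powers (ps : seq (S * int)) : free_group :=
  (\prod_(p <- ps) expgz (gen p.1) p.2)%g.

Lemma factorization_eval ps : factorization (eval_powers ps) = wmul ps [::].
Proof.
elim: ps => [|[s k] ps IH]; first by rewrite /eval_powers big_nil.
rewrite /eval_powers big_cons -/(eval_powers _) factorizationM.
rewrite factorization_expgz wmul_push ?factorization_reduced //.
by rewrite [wmul [::] _]/= IH.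
Qed.

Lemma eval_factorization x : eval_powers (factorization x) = x.
Proof.
by apply: val_inj; rewrite /= factorization_eval wmulw1 ?factorization_reduced.
Qed.

Lemma size_push p w :
  (size (push p w) <= (size w).+1)%N /\
  (size (push p w) = (size w).+1 -> push p w = p :: w).
Proof.
rewrite /push; case: ifP => _; first by split=> //; lia.
by case: w => [|q w] //; case: ifP => _ //; case: ifP => _ /=; split; lia.
Qed.

Lemma size_wmul1 u :
  (size (wmul u [::]) <= size u)%N /\
  (size (wmul u [::]) = size u -> wmul u [::] = u).
Proof.
elim: u => [|p u [h1 h2]] //=.
have [h3 h4] := size_push p (wmul u [::]); split; first by lia.
move=> e; have e' : size (wmul u [::]) = size u by move: h1 h3 e => /=; lia.
by rewrite (h4 (etrans e (congr1 succn (esym e')))) (h2 e').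
Qed.

Lemma factorization_shortest x ps : eval_powers ps = x ->
  (size (factorization x) <= size ps)%N /\
  (size ps = size (factorization x) -> ps = factorization x).
Proof.
move=> <-; rewrite factorization_eval; have [h1 h2] := size_wmul1 ps.
by split=> // e; rewrite h2.
Qed.

End FreeGroup.
Arguments free_group : clear implicits.

Section UniversalProperty.
Context {S : choiceType} {H : groupType}.
Implicit Types (f : S -> H) (h : H) (k l : int).

Lemma expgzS h k : expgz h (k + 1) = (expgz h k * h)%g.
Proof.
case: k => n; first by rewrite -PoszD addn1 /= expgSr.
case: n => [|n]; first by rewrite /= expg1 mulVg.
rewrite (_ : Negz n.+1 + 1 = Negz n) /=; last by rewrite !NegzE; lia.
by rewrite [in RHS]expgS invgM mulgVK.
Qed.

Lemma expgzD h k l : expgz h (k + l) = (expgz h k * expgz h l)%g.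
Proof.
elim/int_rect: l => [|n IH|n IH]; first by rewrite addr0 /= mulg1.
  by rewrite -addn1 PoszD addrA !expgzS IH mulgA.
apply: (@mulIg _ h); rewrite -expgzS -mulgA -expgzS -!addrA.
by rewrite (_ : - n.+1%:Z + 1 = - n%:Z) //; lia.
Qed.

Definition fg_lift f (x : free_group S) : H :=
  (\prod_(p <- factorization x) expgz (f p.1) p.2)%g.

Lemma fg_lift_morphism f : {morph fg_lift f : x y / x * y >-> x * y}%g.
Proof.
move=> x y; rewrite /fg_lift.
rewrite factorizationM; elim: (factorization x) => [|p u IH] /=.
  by rewrite big_nil mul1g.
rewrite big_cons -mulgA -{}IH; set w := wmul u y.
rewrite /push; case: eqP => [->|_]; first by rewrite mul1g.
case: w => [|q w]; first by rewrite !big_cons.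
case: eqP => [pq|_]; last by rewrite big_cons.
by case: eqP => pq0; rewrite !big_cons mulgA -pq -expgzD ?pq0 ?mul1g.
Qed.

Lemma fg_lift_gen f s : fg_lift f (gen s) = f s.
Proof. by rewrite /fg_lift big_seq1 /= expg1. Qed.

Lemma free_group_universal f :
  exists! phi : free_group S -> H,
    {morph phi : x y / x * y >-> x * y}%g /\ forall s, phi (gen s) = f s.
Proof.
exists (fg_lift f); split.
  by split; [exact: fg_lift_morphism | exact: fg_lift_gen].
move=> phi [phim phig].
have phi1 : phi 1%g = 1%g by apply: (@mulgI _ (phi 1%g)); rewrite -phim !mulg1.
pose phiM : UMagmaMorphism.type (free_group S) H :=
  HB.pack phi (isUMagmaMorphism.Build _ _ phi (phi1, phim)).
apply/funext => x; rewrite -[x in RHS]eval_factorization.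
rewrite /eval_powers -[RHS]/(phiM _) gmulf_prod; apply: eq_bigr => p _.
by case: p.2 => n; rewrite [expgz (gen _) _]/expgz ?gmulfV gmulfXn /= phig.
Qed.

End UniversalProperty.

Section Quasimorphisms.
Context {R : realType}.
Implicit Types sigma : nat -> R.

(* Sequences are indexed by k >= 1, the value sigma 0 is ignored. *)
Definition odd_ext sigma (k : int) : R :=
  match k with
  | Posz 0 => 0
  | Posz n => sigma n
  | Negz n => - sigma n.+1
  end.

Definition seq_defect sigma : R :=
  sup_norm (fun '((k, l) : int * int) =>
    odd_ext sigma k + odd_ext sigma l - odd_ext sigma (k + l)).

Context {S : choiceType}.
Implicit Types (p q : S * int) (u v : seq (S * int)).

Definition gsigma sigma (x : free_group S) : R :=
  \sum_(p <- factorization x) odd_ext sigma p.2.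

Lemma gsigma_power sigma s k :
  gsigma sigma (expgz (gen s : free_group S) k) = odd_ext sigma k.
Proof.
rewrite /gsigma factorization_expgz /push /=.
by case: eqP => [->|_]; rewrite ?big_nil ?big_seq1.
Qed.

Lemma odd_extN sigma k : odd_ext sigma (- k) = - odd_ext sigma k.
Proof. by case: k => [[|n]|n] //=; rewrite ?oppr0 ?opprK. Qed.

Lemma wmul_junction u p q v : p.1 = q.1 ->
  reduced (rcons u p) -> reduced (q :: v) -> wmul u (q :: v) = u ++ q :: v.
Proof.
move=> pq ru rv; elim: u ru => //= a u IH.
rewrite reduced_cons => /and3P[a0 au /[dup] ru /IH ->].
rewrite /push (negPf a0); case: u au {IH ru} => [|b u] /= /negPf.
  by rewrite pq => ->.
by move=> ->.
Qed.

Lemma gsigma_quasimorphism sigma :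
  bounded_fun sigma -> quasimorphism (gsigma sigma).
Proof.
move=> /bounded_funP[M hM]; apply/bounded_funP; exists (M + M + M) => -[x y].
have hM' k : `|odd_ext sigma k| <= M.
  case: k => [[|n]|n] /=; rewrite ?normrN ?hM // normr0.
  exact: le_trans (normr_ge0 _) (hM 0%N).
have M0 : 0 <= M := le_trans (normr_ge0 _) (hM 0%N).
rewrite /gsigma factorizationM.
move: (factorization_reduced x) (factorization_reduced y).
elim/last_ind: (factorization x) (factorization y) => [|u [s k] IH] v ru rv.
  by rewrite big_nil add0r subrr normr0; lra.
have k0 : k != 0.
  by case/andP: ru; rewrite all_rcons => /andP[].
have ru' : reduced u.
  move: ru; rewrite /reduced all_rcons => /andP[/andP[_ ->]] /=.
  by rewrite -cats1 => /cat_sorted2[].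
have wmul_rcons w : wmul (rcons u (s, k)) w = wmul u (push (s, k) w).
  by rewrite /wmul foldr_rcons.
have sumE p w : p.1 = s -> reduced (p :: w) ->
    \sum_(q <- wmul u (p :: w)) odd_ext sigma q.2 =
    \sum_(q <- u) odd_ext sigma q.2 +
      (odd_ext sigma p.2 + \sum_(q <- w) odd_ext sigma q.2).
  move=> ps rw; rewrite (@wmul_junction u (s, k)) ?big_cat ?big_cons //.
rewrite wmul_rcons big_rcons /=.
case: v rv => [|[t m] v] rv; rewrite /push /= (negPf k0).
  rewrite sumE // ?big_nil ?reduced_cons ?k0 //=.
  by rewrite !addr0 subrr normr0; lra.
case: (altP (s =P t)) => [st|st]; last first.
  rewrite sumE //; last by rewrite [reduced _]reduced_cons k0 st rv.
  by rewrite addrA subrr normr0; lra.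
rewrite big_cons /=; move: rv; rewrite reduced_cons /= => /and3P[m0 tv rv].
case: (altP (k + m =P 0)) => [km|km].
  have -> : m = - k by apply/eqP; rewrite -addr_eq0 addrC km.
  by rewrite odd_extN addrA addrK; exact: IH.
rewrite sumE // ?reduced_cons ?km ?st //= ?tv //.
set a := \sum_(q <- u) _; set b := \sum_(q <- v) _.
rewrite (_ : _ - _ = odd_ext sigma k + odd_ext sigma m - odd_ext sigma (k + m)).
  by rewrite (le_trans (ler_normB _ _)) ?lerD // (le_trans (ler_normD _ _)) ?lerD.
ring.
Qed.

End Quasimorphisms.

(* Main.v *)
Require Import Defs.
From mathcomp Require Import all_boot all_order all_algebra.
From mathcomp Require Import all_classical all_reals.
From mathcomp Require Import topology normedtype.
From mathcomp Require Import zify ring lra.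

Set Implicit Arguments.
Unset Strict Implicit.
Unset Printing Implicit Defensive.

Import Order.TTheory GRing.Theory Num.Theory.
Import numFieldNormedType.Exports.

Local Open Scope ring_scope.

(** Let D a b := sigma a + sigma b - sigma (a + b). In a product x y of reduced
    words, a suffix c of x cancels against a prefix c^-1 of y, and then either
    nothing else happens, or two powers s^a and s^b of one letter merge into
    s^(a+b) ([junction]). As sigma is odd, g_sigma is additive up to this one
    merge, so d g_sigma (x, y) is 0 = D 0 0 or D a b ([coboundary1_gsigma]).
    Hence the sup norm of d g_sigma is at most def sigma, and so is the norm
    of its class.

    For the converse, let d g_sigma + d b be another representative, with b
    bounded, and let C be its sup norm. Fix k, l and put

      X = t^k s^k,  Y = s^l t^l,  Z = (X Y)^-1.

    These are the boundary curves of a pair of pants with fundamental group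
    <s, t>. It is the union of two ideal triangles, which lift to the tree of
    the free group as tripods centred on a t-line and on an s-line, with legs
    at mutual offsets k and l in both cases. Truncating the ideal vertices at
    the heights n, m and r in the three cusps turns the triangles into
    2-simplices on which d g_sigma is - D k l and D k l respectively. Up to
    reindexing, with

      U n m = X^-n Y^m,  V m r = Y^-m Z^r,  W n r = X^-n Z^r,

    these simplices are the factorizations

      U n m V m r = W n r,   U n m V (m-1) r = W (n+1) (r-1),

    the second because Y = X^-1 Z^-1. Evaluating d g_sigma + d b on both and
    subtracting, the two copies of b (U n m) cancel, which leaves

      |2 D k l + (b-differences of V in m) + (b-differences of W along
       the antidiagonals n + r = const)| <= 2 C

    up to signs. Both differences telescope and b is bounded, so averaging
    removes them ([double_telescoping]) and |D k l| <= C
    ([sigma_defect_le]).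

    All words U, V, W alternate between s and t, so they are handled as lists
    of exponents ([zigzag]). *)

(** * Words in the free group *)

Section Words.
Context {S : choiceType}.
Implicit Types (s t : S) (a b k l : int) (p q : S * int).
Implicit Types (u v w c : seq (S * int)) (es fs : seq int).

Lemma reduced_cat u p v :
  reduced (u ++ p :: v) = reduced (rcons u p) && reduced (p :: v).
Proof.
rewrite /reduced -cats1 !all_cat /= (sorted_cat_cons _ u p [::]).
rewrite (sorted_cat_cons _ u p v) /=.
by case: (all _ u); case: (p.2 != 0); case: (all _ v); rewrite ?andbF ?andbT.
Qed.

Lemma reduced_rcons u p q :
  p.1 = q.1 -> q.2 != 0 -> reduced (rcons u p) -> reduced (rcons u q).
Proof.
move=> pq q0; rewrite -!cats1.
elim: u => [|r u IH]; first by rewrite /= !reduced_cons q0.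
rewrite !cat_cons !reduced_cons => /and3P[-> ru /IH ->].
by case: u ru {IH} => [|r' u] /=; rewrite ?pq => ->.
Qed.

Lemma winv_rcons u p : winv (rcons u p) = (p.1, - p.2) :: winv u.
Proof. by rewrite /winv map_rcons rev_rcons. Qed.

Lemma winv_cons p u : winv (p :: u) = rcons (winv u) (p.1, - p.2).
Proof. by rewrite /winv map_cons rev_cons. Qed.

Lemma eval_powers_cat u v :
  eval_powers (u ++ v) = (eval_powers u * eval_powers v)%g.
Proof. exact: big_cat. Qed.

Lemma eval_powers_cons p u :
  eval_powers (p :: u) = (expgz (gen p.1) p.2 * eval_powers u)%g.
Proof. exact: big_cons. Qed.

Lemma eval_powers_winv u : (eval_powers u * eval_powers (winv u) = 1)%g.
Proof.
elim: u => [|p u IH]; first by rewrite /eval_powers big_nil mulg1.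
rewrite winv_cons -cats1 eval_powers_cat !eval_powers_cons -mulgA.
rewrite (mulgA (eval_powers u)).
by rewrite IH mul1g mulgA -expgzD subrr /eval_powers big_nil mul1g.
Qed.

(** The product of two words whose paths in the tree branch on a common s-line:
    [u], [winv c] and [v] are the three legs of the tripod. *)
Lemma eval_tripod s a b u c v :
  (eval_powers (u ++ (s, a) :: c) * eval_powers (winv c ++ (s, b) :: v) =
   eval_powers (u ++ (s, (a + b)%R) :: v))%g.
Proof.
rewrite !eval_powers_cat !eval_powers_cons /= expgzD -!mulgA.
congr (_ * (_ * _))%g.
by rewrite !mulgA eval_powers_winv mul1g.
Qed.

(** Cancellation at the junction of two reduced words either stops between
    distinct letters (or at the end of a word), or stops by merging two powers
    of the same letter into a nontrivial one. The case distinction is on the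
    last power of [u] and the first of [v]; if they are inverse, they join the
    cancelled part [c], and the next pair of powers decides. *)
Lemma junction u v : reduced u -> reduced v ->
  (exists u' c v', [/\ u = u' ++ c, v = winv c ++ v' & reduced (u' ++ v')]) \/
  (exists s a b, exists u' c v', [/\ u = u' ++ (s, a) :: c,
     v = winv c ++ (s, b) :: v' & reduced (u' ++ (s, a + b) :: v')]).
Proof.
elim/last_ind: u v => [|u [s k] IH] v ru rv.
  by left; exists [::], [::], v.
case: v rv => [|[t m] v] rv.
  by left; exists (rcons u (s, k)), [::], [::]; rewrite !cats0.
have k0 : k != 0 by case/andP: ru; rewrite all_rcons => /andP[].
have := rv; rewrite reduced_cons => /and3P[/= m0 tv rv'].
have [st|st] := eqVneq s t; last first.
  left; exists (rcons u (s, k)), [::], ((t, m) :: v); rewrite cats0; split=> //.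
  by rewrite cat_rcons reduced_cat ru reduced_cons /= k0 st rv.
have [km|km] := eqVneq (k + m) 0; last first.
  right; exists s, k, m, u, [::], v; rewrite cats1 -st; split=> //.
  rewrite reduced_cat (@reduced_rcons u (s, k)) // reduced_cons /= km.
  by rewrite {1}st tv.
have cancel c : (t, m) :: winv c = winv (rcons c (s, k)).
  by rewrite winv_rcons /= st -(addr0_eq km).
have ru' : reduced u.
  move: ru; rewrite /reduced all_rcons -cats1.
  by move=> /andP[/andP[_ ->] /cat_sorted2[]].
case: (IH v ru' rv') => [[u' [c [v' [-> -> rw]]]]|].
  by left; exists u', (rcons c (s, k)), v'; rewrite -cancel rcons_cat.
move=> [s' [a [b [u' [c [v' [-> -> rw]]]]]]].
by right; exists s', a, b, u', (rcons c (s, k)), v'; rewrite -cancel rcons_cat.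
Qed.

Fixpoint zigzag s t es : seq (S * int) :=
  if es is e :: es' then (s, e) :: zigzag t s es' else [::].

Lemma zigzag_reduced s t es :
  s != t -> all (fun e : int => e != 0) es -> reduced (zigzag s t es).
Proof.
elim: es s t => [|e es IH] s t st //= /andP[e0 es0].
rewrite reduced_cons /= e0 IH 1?eq_sym // andbT.
by case: es {IH es0}.
Qed.

Lemma zigzag_cat s t es fs : zigzag s t (es ++ fs) =
  zigzag s t es ++ (if odd (size es) then zigzag t s fs else zigzag s t fs).
Proof.
elim: es s t => [|e es IH] s t //=.
by rewrite IH; case: odd.
Qed.

Lemma winv_zigzag s t es : winv (zigzag s t es) =
  let fs := rev [seq - e | e <- es] in
  if odd (size es) then zigzag s t fs else zigzag t s fs.
Proof.
elim: es s t => [|e es IH] s t //=.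
rewrite winv_cons IH /= rev_cons -!cats1 !zigzag_cat !size_rev size_map.
by case: odd.
Qed.

End Words.

(** * The values of the coboundary of g_sigma *)

Section Defect.
Context {R : realType} {S : choiceType} (sigma : nat -> R).
Implicit Types (s t : S) (a b k l : int) (u v c : seq (S * int)).
Notation g := (@gsigma R S sigma).

Definition sigma_defect a b : R :=
  odd_ext sigma a + odd_ext sigma b - odd_ext sigma (a + b).

Lemma gsigma_eval u :
  reduced u -> g (eval_powers u) = \sum_(p <- u) odd_ext sigma p.2.
Proof. by move=> ru; rewrite /gsigma factorization_eval wmulw1. Qed.

Lemma sum_odd_ext_winv u :
  \sum_(p <- winv u) odd_ext sigma p.2 = - \sum_(p <- u) odd_ext sigma p.2.
Proof.
elim: u => [|p u IH]; first by rewrite !big_nil oppr0.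
by rewrite winv_cons big_rcons /= IH big_cons odd_extN opprD addrC.
Qed.

(** The leg [c] contributes to x and y with opposite signs because sigma is
    odd, and the legs [u] and [v] reappear in the product; only the merge is
    seen by the coboundary. *)
Lemma coboundary1_tripod s a b u c v :
  reduced (u ++ (s, a) :: c) -> reduced (winv c ++ (s, b) :: v) ->
  reduced (u ++ (s, a + b) :: v) ->
  coboundary1 g (eval_powers (u ++ (s, a) :: c),
                 eval_powers (winv c ++ (s, b) :: v)) = sigma_defect a b.
Proof.
move=> rx ry rxy; rewrite /coboundary1 eval_tripod !gsigma_eval //.
rewrite !big_cat !big_cons sum_odd_ext_winv /= /sigma_defect; ring.
Qed.

Lemma coboundary1_gsigma x y :
  exists a b, coboundary1 g (x, y) = sigma_defect a b.
Proof.
rewrite -(eval_factorization x) -(eval_factorization y).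
have rx := factorization_reduced x; have ry := factorization_reduced y.
have [[u [c [v [ex ey rw]]]]|[s [a [b [u [c [v [ex ey rw]]]]]]]] :=
  junction rx ry.
  exists 0, 0; rewrite /coboundary1.
  have -> : (eval_powers x * eval_powers y = eval_powers (u ++ v))%g.
    rewrite ex ey !eval_powers_cat -!mulgA; congr (_ * _)%g.
    by rewrite mulgA eval_powers_winv mul1g.
  rewrite !gsigma_eval // ex ey !big_cat sum_odd_ext_winv /sigma_defect /=.
  ring.
exists a, b; rewrite ex ey in rx ry *; exact: coboundary1_tripod.
Qed.

Lemma odd_ext_bounded : bounded_fun sigma ->
  exists B, forall k, `|odd_ext sigma k| <= B.
Proof.
move=> /Defs.bounded_funP[M hM]; exists M => k.
case: k => [[|n]|n] /=; rewrite ?normrN ?hM // normr0.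
exact: le_trans (normr_ge0 _) (hM 0%N).
Qed.

(** Tripods of alternating words. The parity condition makes the first word
    end with t, which is the initial letter of the second one; so the powers
    with exponents [a] and [b] belong to the same letter, s or t according to
    the parity of [size es]. *)
Lemma coboundary1_zigzag s t es a b cs fs :
  s != t -> odd (size es + size cs) ->
  all (fun e : int => e != 0) (es ++ a :: cs) ->
  all (fun e : int => e != 0) (rev [seq - e | e <- cs] ++ b :: fs) ->
  all (fun e : int => e != 0) (es ++ a + b :: fs) ->
  let x := eval_powers (zigzag s t (es ++ a :: cs)) in
  let y := eval_powers (zigzag t s (rev [seq - e | e <- cs] ++ b :: fs)) in
  (x * y)%g = eval_powers (zigzag s t (es ++ a + b :: fs)) /\
  coboundary1 g (x, y) = sigma_defect a b.
Proof.
move=> st; rewrite oddD => par nx ny nxy x y.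
have ts : t != s by rewrite eq_sym.
have := zigzag_reduced st nxy; have := zigzag_reduced ts ny.
have := zigzag_reduced st nx.
rewrite {}/x {}/y !zigzag_cat size_rev size_map /=.
have := winv_zigzag t s cs; have := winv_zigzag s t cs.
case: (odd (size es)) (odd (size cs)) par => [] [] //= _ w1 w2 rx ry rxy.
  rewrite -w1 in ry *; split; first exact: eval_tripod.
  exact: (coboundary1_tripod rx ry rxy).
rewrite -w2 in ry *; split; first exact: eval_tripod.
exact: (coboundary1_tripod rx ry rxy).
Qed.

End Defect.

(** * Averaging out bounded telescoping terms *)

Section Averaging.
Context {R : realType}.
Implicit Types (a x y B C D : R).

Lemma le_of_linear_growth x y C :
  (forall N : nat, x * N%:R <= y * N%:R + C) -> x <= y.
Proof.
move=> h; rewrite leNgt; apply/negP => yx.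
have d0 : 0 < x - y by rewrite subr_gt0.
have := archi_boundP (divr_ge0 (normr_ge0 C) (ltW d0)).
set N := Num.bound _ => hN.
have := h N; rewrite -lerBlDl -mulrBl leNgt => /negP; apply.
by rewrite (le_lt_trans (ler_norm C)) // mulrC -ltr_pdivrMr.
Qed.

Lemma telescoping_bound a B D (u : nat -> R) (N : nat) :
  (forall i, (i < N)%N -> `|a + (u i.+1 - u i)| <= D) ->
  (forall i, `|u i| <= B) -> `|a| * N%:R <= D * N%:R + 2 * B.
Proof.
move=> h hu.
have e : a * N%:R = \sum_(0 <= i < N) (a + (u i.+1 - u i)) - (u N - u 0%N).
  rewrite big_split /= telescope_sumr // addrK.
  by rewrite sumr_const_nat subn0 mulr_natr.
have -> : `|a| * N%:R = `|a * N%:R| by rewrite normrM normr_nat.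
rewrite e; apply: le_trans (ler_normB _ _) _; apply: lerD.
  apply: le_trans (ler_norm_sum _ _ _) _.
  have -> : D * N%:R = \sum_(0 <= i < N) D.
    by rewrite sumr_const_nat subn0 mulr_natr.
  by rewrite !big_mkord; apply: ler_sum => i _; exact: h.
by apply: le_trans (ler_normB _ _) _; have := hu N; have := hu 0%N; lra.
Qed.

(** Averaging first over [i] with [n] and [r] fixed removes [v]. The terms of
    [w] then telescope along an antidiagonal n + r = N. *)
Lemma double_telescoping a B D (v w : nat -> nat -> R) :
  (forall i r, `|v i r| <= B) -> (forall n r, `|w n r| <= B) ->
  (forall i n r,
     `|a + (v i.+1 r - v i r) + (w n.+1 r - w n r.+1)| <= D) ->
  `|a| <= D.
Proof.
move=> hv hw h.
have hr n r : `|a + (w n.+1 r - w n r.+1)| <= D.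
  apply: (@le_of_linear_growth _ _ (2 * B)) => N.
  apply: (@telescoping_bound _ _ _ (v^~ r)) => // i _.
  by rewrite addrAC.
apply: (@le_of_linear_growth _ _ (2 * B)) => N.
apply: (@telescoping_bound _ _ _ (fun j => w j (N - j)%N)) => // j jN.
by rewrite -(subnSK jN).
Qed.

End Averaging.

(** * The lower bound *)

Section LowerBound.
Context {R : realType} {S : choiceType} (sigma : nat -> R).
Notation g := (@gsigma R S sigma).
Implicit Types (k l : int).

Lemma cat_nseq_cons (n : nat) (k : int) es :
  nseq n k ++ k :: es = nseq n.+1 k ++ es.
Proof. by rewrite -[in RHS]addn1 nseqD -catA. Qed.

Lemma sigma_defectN k l :
  sigma_defect sigma (- k) (- l) = - sigma_defect sigma k l.
Proof. by rewrite /sigma_defect -opprD !odd_extN; ring. Qed.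

(** Any cocycle cohomologous to the coboundary of g_sigma is tested on the two
    families of tripods coming from the ideal triangulation of the pair of
    pants with boundary words t^k s^k, s^l t^l and t^k s^(k+l) t^l. *)
Lemma sigma_defect_le (s t : S) (b : free_group S -> R) D k l :
  s != t -> bounded_fun b ->
  (forall z, `|coboundary1 g z + coboundary1 b z| <= D) ->
  `|sigma_defect sigma k l| <= D.
Proof.
move=> st /Defs.bounded_funP[B hB] hD.
have D0 : 0 <= D := le_trans (normr_ge0 _) (hD (1%g, 1%g)).
have odd_ext0 : odd_ext sigma 0 = 0 by [].
have [k0|k0] := eqVneq k 0.
  by rewrite k0 /sigma_defect odd_ext0 !add0r subrr normr0.
have [l0|l0] := eqVneq l 0.
  by rewrite l0 /sigma_defect odd_ext0 !addr0 subrr normr0.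
have [m0|m0] := eqVneq (k + l) 0.
  rewrite /sigma_defect m0 odd_ext0 -(addr0_eq m0) odd_extN.
  by rewrite subr0 subrr normr0.
(* The truncated edges X^-n Y^m, Y^-m Z^(r+1) and X^-(n+1) Z^r, written as *)
(* reduced words; all exponents are nonzero since k, l and k + l are.      *)
pose U n m := eval_powers (zigzag s t (nseq n.*2 (- k) ++ nseq m.*2 l)).
pose V m r := eval_powers (zigzag t s
  (nseq m.*2.+1 (- l) ++ nseq r.*2.+1 (- (k + l)) ++ [:: - k])).
pose W n r := eval_powers (zigzag s t
  (nseq n.*2.+1 (- k) ++ nseq r.*2 (- (k + l)) ++ [:: - k])).
have nz : (- k != 0) * (- l != 0) * (- (k + l) != 0) by rewrite !oppr_eq0.
(* The two triangles on either side of an edge U: the first one is centred *)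
(* on a t-line, the second one on an s-line.                               *)
have tripod1 n m r : (U n.+1 m * V m r)%g = W n r.+1 /\
    coboundary1 g (U n.+1 m, V m r) = - sigma_defect sigma k l.
  have := @coboundary1_zigzag _ _ sigma s t (nseq n.*2.+1 (- k)) (- k) (- l)
    (nseq m.*2 l) (nseq r.*2.+1 (- (k + l)) ++ [:: - k]) st.
  rewrite sigma_defectN -opprD map_nseq rev_nseq !size_nseq !cat_nseq_cons.
  by apply; rewrite ?oddD ?oddS ?odd_double //;
    do !rewrite /= ?all_cat ?all_nseq ?nz ?l0 ?orbT.
have tripod2 n m r : (U n.+1 m.+1 * V m r)%g = W n.+1 r /\
    coboundary1 g (U n.+1 m.+1, V m r) = sigma_defect sigma k l.
  have := @coboundary1_zigzag _ _ sigma s t (nseq n.+1.*2 (- k)) l (- (k + l))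
    (nseq m.*2.+1 l) (nseq r.*2 (- (k + l)) ++ [:: - k]) st.
  have -> : sigma_defect sigma l (- (k + l)) = sigma_defect sigma k l.
    rewrite /sigma_defect (_ : l - (k + l) = - k); last by lia.
    by rewrite !odd_extN; ring.
  have -> : l - (k + l) = - k by lia.
  rewrite map_nseq rev_nseq !size_nseq !cat_nseq_cons.
  by apply; rewrite ?oddD ?oddS ?odd_double //;
    do !rewrite /= ?all_cat ?all_nseq ?nz ?l0 ?orbT.
(* Both triangles are taken on the edge U n.+1 i.+1, so that the value of b *)
(* on this edge cancels in the difference.                                  *)
have main : `|- (2 * sigma_defect sigma k l)| <= 2 * D.
  apply: (@double_telescoping _ _ B _ (fun i r => b (V i r))
    (fun n r => b (W n r))) => // i n r.
  have [p1 d1] := tripod1 n i.+1 r; have [p2 d2] := tripod2 n i r.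
  have := hD (U n.+1 i.+1, V i.+1 r); have := hD (U n.+1 i.+1, V i r).
  rewrite d1 d2 /coboundary1 p1 p2 !ler_norml; lra.
by move: main; rewrite normrN normrM normr_nat; lra.
Qed.

End LowerBound.

(** * The Gromov norm *)

Section SupNorm.
Context {R : realType} {T : Type}.
Implicit Types (f : T -> R).

Lemma le_sup_norm f : bounded_fun f -> forall x, `|f x| <= sup_norm f.
Proof.
move=> /Defs.bounded_funP[M hM] x; apply: ub_le_sup; last by exists x.
by exists M => _ [y _ <-].
Qed.

Lemma sup_norm_le f D : T -> (forall x, `|f x| <= D) -> sup_norm f <= D.
Proof.
move=> x0 hf; apply: ge_sup; first by exists `|f x0|; exists x0.
by move=> _ [y _ <-].
Qed.

End SupNorm.

Theorem proposition3p8 (R : realType) (S : choiceType)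
    (S_ge2 : exists s t : S, s != t)
    (sigma : nat -> R) (sigma_bounded : bounded_fun sigma) :
  gromov_norm
    (bclass (coboundary_cocycle
      (gsigma_quasimorphism sigma_bounded : quasimorphism (@gsigma R S sigma))))
  = seq_defect sigma.
Proof.
have [s [t st]] := S_ge2.
have [B hB] := odd_ext_bounded sigma_bounded.
have defect_bounded :
    bounded_fun (fun '((k, l) : int * int) => sigma_defect sigma k l).
  apply/Defs.bounded_funP; exists (B + B + B) => -[k l].
  rewrite (le_trans (ler_normB _ _)) ?lerD //.
  by rewrite (le_trans (ler_normD _ _)) ?lerD.
set z := coboundary_cocycle _.
have lower c : bclass c = bclass z -> seq_defect sigma <= sup_norm (cochain c).
  move=> /bclass_eqP[b bb cb].
  apply: sup_norm_le => [|[k l]]; first exact: (0, 0).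
  apply: (@sigma_defect_le _ _ sigma s t b) => // x; rewrite -cb.
  rewrite [X in `|X|](subrKC _ (cochain c x)); apply: le_sup_norm.
  by have /asboolP[] := valP c.
apply/le_anti/andP; split.
  apply: (@le_trans _ _ (sup_norm (cochain z))).
    apply: ge_inf; last by exists z.
    by exists (seq_defect sigma) => _ [c /lower ? <-].
  apply: sup_norm_le => [|[x y]]; first exact: (1%g, 1%g).
  have [a [b e]] := coboundary1_gsigma sigma x y.
  rewrite [cochain z _]e; exact: (le_sup_norm defect_bounded (a, b)).
apply: lb_le_inf; first by exists (sup_norm (cochain z)), z.
by move=> _ [c /lower ? <-].
Qed.
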